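(* Let $\mathbb{K}=\mathbb{R}$ or $\mathbb{C}$, and let $A\in\mathbb{K}^{m\times n}$, $B\in\mathbb{K}^{n\times k}$ be two non-zero matrices, of ranks $r_A$ and $r_B$, such that $(AB)^{+}=B^{+}A^{+}$. Then there exist singular value decompositions $A=U_A\Sigma_A V_A^*$ and $B=U_B\Sigma_B V_B^*$ such that $\mathcal{C}(B)$ is spanned by some columns of the matrix $V_A$, $\mathcal{C}(A^* )$ is spanned by some columns of the matrix $U_B$, and $$\operatorname{span}\big(u_{B,i} \mid u_{B,i}\notin\mathcal{N}(A),\ i\in\{1,\ldots,r_B\}\big)=\operatorname{span}\big(v_{A,i} \mid v_{A,i}\notin\mathcal{N}(B^* ),\ i\in\{1,\ldots,r_A\}\big),$$ where $u_{B,i}\in\mathbb{K}^n$ is the $i$-th column of $U_B$ and $v_{A,i}\in\mathbb{K}^n$ is the $i$-th column of $V_A$.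
   Context: $M^*$ is the conjugate transpose, $M^{+}$ the Moore--Penrose pseudoinverse, $\mathcal{C}(M)$ the column space and $\mathcal{N}(M)$ the null space of $M$. A singular value decomposition of $M\in\mathbb{K}^{p\times q}$ of rank $r$ is $M=U\Sigma V^*$ with $U\in\mathbb{K}^{p\times p}$, $V\in\mathbb{K}^{q\times q}$ unitary (orthogonal over $\mathbb{R}$) and $\Sigma=\operatorname{diag}(\sigma_1,\ldots,\sigma_r,0,\ldots,0)\in\mathbb{R}^{p\times q}$ with $\sigma_1\ge\cdots\ge\sigma_r>0$. The span of the empty set is $\{0\}$. *)

(* Defs.v *)
From HB Require Import structures.
From mathcomp Require Import all_boot all_order all_algebra.
From mathcomp Require Import classical_sets reals complex.

Set Implicit Arguments.
Unset Strict Implicit.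
Unset Printing Implicit Defensive.

Import Order.TTheory GRing.Theory Num.Theory.
Local Open Scope ring_scope.

(* Both scalar fields are numFieldTypes; conjugation is carried along with the
   field because the library only has it on numClosedFieldType. *)
Inductive real_or_complex (R : realType) :
    forall K : numFieldType, {rmorphism K -> K} -> Prop :=
  | RealScalars : @real_or_complex R R idfun
  | ComplexScalars : @real_or_complex R R[i] (@conjc R).

Section Definitions.
Variables (K : numFieldType) (conj : {rmorphism K -> K}).

Definition ctrmx p q (M : 'M[K]_(p, q)) : 'M[K]_(q, p) := map_mx conj M^T.

Definition is_unitary p (U : 'M[K]_p) : Prop := U *m ctrmx U = 1%:M.

Definition penrose p q (M : 'M[K]_(p, q)) (X : 'M[K]_(q, p)) : Prop :=
  [/\ M *m X *m M = M,
      X *m M *m X = X,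
      ctrmx (M *m X) = M *m X
    & ctrmx (X *m M) = X *m M].

(* The value 0 is only a formal default, see [mp_pinvP] and [mp_pinv_unique]. *)
Definition mp_pinv p q (M : 'M[K]_(p, q)) : 'M[K]_(q, p) :=
  xget 0 (penrose M).

(* In a numFieldType, 0 < x forces x to be real, so the diagonal entries of S
   are real also when K is the field of complex numbers. *)
Definition is_singular_diag p q (r : nat) (S : 'M[K]_(p, q)) : Prop :=
  exists sigma : nat -> K,
    [/\ forall i, (i < r)%N -> 0 < sigma i,
        forall i j, (i <= j)%N -> (j < r)%N -> sigma j <= sigma i
      & S = \matrix_(i, j)
              (if (i == j :> nat) && (i < r)%N then sigma i else 0)].

Definition is_svd p q (M : 'M[K]_(p, q))
    (U : 'M[K]_p) (S : 'M[K]_(p, q)) (V : 'M[K]_q) : Prop :=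
  [/\ is_unitary U, is_unitary V, is_singular_diag (\rank M) S
    & M = U *m S *m ctrmx V].

End Definitions.

Section Subspaces.
Variable K : fieldType.

Definition colspace p q (M : 'M[K]_(p, q)) : {vspace 'cV[K]_p} :=
  <<[seq col j M | j <- enum 'I_q]>>%VS.

Definition nullspace p q (M : 'M[K]_(p, q)) : {vspace 'cV[K]_q} :=
  lker (linfun (mulmx M)).

Definition colspan p q (M : 'M[K]_(p, q)) (P : pred 'I_q) : {vspace 'cV[K]_p} :=
  <<[seq col j M | j <- enum 'I_q & P j]>>%VS.

Lemma mem_nullspace p q (M : 'M[K]_(p, q)) (v : 'cV[K]_q) :
  (v \in nullspace M) = (M *m v == 0).
Proof. by rewrite memv_ker lfunE. Qed.

End Subspaces.

Section PseudoInverse.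
Variables (R : realType) (K : numFieldType) (conj : {rmorphism K -> K}).
Hypothesis RC : real_or_complex R conj.
Local Notation "M ^H" := (ctrmx conj M) (at level 2, format "M ^H").

Lemma rc_conjK : involutive conj.
Proof. by case: RC => [|] x //=; rewrite ?conjcK. Qed.

Lemma rc_mul_conj_ge0 x : 0 <= x * conj x.
Proof.
case: RC x => [|] x /=; first by rewrite -expr2 sqr_ge0.
exact: mul_conjC_ge0.
Qed.

Lemma ctrmxM p q s (M : 'M[K]_(p, q)) (N : 'M[K]_(q, s)) :
  (M *m N)^H = N^H *m M^H.
Proof. by rewrite /ctrmx trmx_mul map_mxM. Qed.

Lemma ctrmxK p q (M : 'M[K]_(p, q)) : M^H^H = M.
Proof. by apply/matrixP=> i j; rewrite !mxE rc_conjK. Qed.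

Lemma ctrmx_inv p (M : 'M[K]_p) : (invmx M)^H = invmx M^H.
Proof. by rewrite /ctrmx trmx_inv map_invmx. Qed.

Lemma mulmx_ctrmx_eq0 p q (M : 'M[K]_(p, q)) : M *m M^H = 0 -> M = 0.
Proof.
move=> M0; apply/matrixP=> i j; rewrite mxE; apply/eqP.
have /eqP := congr1 (fun X : 'M_p => X i i) M0; rewrite !mxE.
rewrite psumr_eq0 => [/allP/(_ j)|j' _]; last by rewrite !mxE rc_mul_conj_ge0.
by rewrite mem_index_enum !mxE mulf_eq0 fmorph_eq0 orbb; apply.
Qed.

Lemma row_free_gram p q (M : 'M[K]_(p, q)) :
  row_free M -> M *m M^H \in unitmx.
Proof.
move=> Mfree; rewrite -row_free_unit -kermx_eq0; apply/eqP.
set L := kermx _; have L0 : L *m (M *m M^H) = 0 by exact: mulmx_ker.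
have /mulmx_ctrmx_eq0 LM0 : (L *m M) *m (L *m M)^H = 0.
  by rewrite ctrmxM mulmxA -(mulmxA L) L0 mul0mx.
by apply: (row_free_inj Mfree); rewrite LM0 mul0mx.
Qed.

Lemma mp_pinv_unique p q (M : 'M[K]_(p, q)) (X Y : 'M[K]_(q, p)) :
  penrose conj M X -> penrose conj M Y -> X = Y.
Proof.
case=> X1 X2 X3 X4 [Y1 Y2 Y3 Y4].
have MXY : M *m X = M *m Y.
  by rewrite -X3 -{1}Y1 -mulmxA ctrmxM X3 Y3 !mulmxA X1.
have XYM : X *m M = Y *m M.
  by rewrite -X4 -{1}Y1 !mulmxA -mulmxA ctrmxM X4 Y4 -mulmxA (mulmxA M) X1.
by rewrite -X2 XYM -mulmxA MXY mulmxA Y2.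
Qed.

Lemma mp_pinvP p q (M : 'M[K]_(p, q)) : penrose conj M (mp_pinv conj M).
Proof.
apply: xgetPex.
have [r [F [G [-> fullF freeG]]]] : exists r (F : 'M_(p, r)) (G : 'M_(r, q)),
    [/\ M = F *m G, row_full F & row_free G].
  exists (\rank M), (col_base M), (row_base M).
  by rewrite mulmx_base col_base_full row_base_free.
have uG : G *m G^H \in unitmx by apply: row_free_gram.
have uF : F^H *m F \in unitmx.
  rewrite -{2}[F]ctrmxK; apply: row_free_gram.
  by rewrite /row_free mxrank_map mxrank_tr.
pose X := G^H *m invmx (G *m G^H) *m (invmx (F^H *m F) *m F^H).
have MX : F *m G *m X = F *m invmx (F^H *m F) *m F^H.
  by rewrite /X -!mulmxA (mulmxA G) (mulKVmx uG).
have XM : X *m (F *m G) = G^H *m invmx (G *m G^H) *m G.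
  by rewrite /X -!mulmxA (mulmxA F^H) (mulKmx uF).
exists X; split.
- by rewrite MX -!mulmxA (mulmxA F^H) (mulKmx uF).
- by rewrite XM /X -!mulmxA (mulmxA G) (mulKVmx uG).
- by rewrite MX !ctrmxM ctrmx_inv ctrmxM ctrmxK mulmxA.
- by rewrite XM !ctrmxM ctrmx_inv ctrmxM ctrmxK mulmxA.
Qed.

End PseudoInverse.

(* Main.v *)
Require Import Defs.
From HB Require Import structures.
From mathcomp Require Import all_boot all_order all_algebra perm.
From mathcomp Require Import classical_sets reals complex.

(** Let P = B B^+ and Q = A^+ A be the orthogonal projectors onto C(B) and
    C(A^* ).  The Penrose equations for the pair (A B, B^+ A^+) force P to commute
    with the Gram matrix A^* A ([reverse_order_commute]); taking conjugate
    transposes exchanges the two factors, so Q commutes with B B^*.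

    Commuting Hermitian matrices have a common orthonormal eigenbasis
    ([joint_diagonalization]).  An eigenbasis of A^* A, sorted by decreasing
    eigenvalue, is the family of right singular vectors of an SVD of A, so V_A can
    be chosen with every column in C(B) or in its orthogonal complement
    ([adapted_svd]); the same applied to B^* and Q gives U_B with every column in
    C(A^* ) or in its orthogonal complement N(A).

    All three equalities are then the remark that a matrix acting on the columns
    of a unitary V by the scalars 0 and 1 has as column space the span of the
    columns it fixes ([colspace_diagonalized]).  It applies to P with V_A and to Q
    with U_B.  For the last equality it applies to P Q with both bases: the leading
    columns of V_A are those fixed by Q and the leading columns of U_B those fixed
    by P ([penrose_svd]), while a column of U_B avoids N(A) exactly when Q fixes it,
    and a column of V_A avoids N(B^* ) exactly when P fixes it ([notin_nullspace]).
    So both sides are C(P Q), the intersection of C(B) and C(A^* ). *)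

Set Implicit Arguments.
Unset Strict Implicit.
Unset Printing Implicit Defensive.

Import Order.TTheory GRing.Theory Num.Theory.
Local Open Scope ring_scope.

(** * Conjugate transposition and squared norms *)

Section ConjugateTranspose.
Variables (R : realType) (K : numFieldType) (conj : {rmorphism K -> K}).
Hypothesis RC : real_or_complex R conj.
Local Notation "M ^H" := (ctrmx conj M) (at level 2, format "M ^H").

Lemma ctrmx0 p q : (0 : 'M[K]_(p, q))^H = 0.
Proof. by rewrite /ctrmx trmx0 map_mx0. Qed.

Lemma ctrmxZ p q a (M : 'M[K]_(p, q)) : (a *: M)^H = conj a *: M^H.
Proof. by apply/matrixP=> i j; rewrite !mxE rmorphM. Qed.

Lemma ctrmxB p q (M N : 'M[K]_(p, q)) : (M - N)^H = M^H - N^H.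
Proof. by apply/matrixP=> i j; rewrite !mxE rmorphB. Qed.

Lemma ctrmx_col_mx p1 p2 q (M : 'M[K]_(p1, q)) (N : 'M[K]_(p2, q)) :
  (col_mx M N)^H = row_mx M^H N^H.
Proof. by rewrite /ctrmx tr_col_mx map_row_mx. Qed.

Lemma rank_ctrmx p q (M : 'M[K]_(p, q)) : \rank M^H = \rank M.
Proof. by rewrite mxrank_map mxrank_tr. Qed.

Lemma conj_nonneg (x : K) : 0 <= x -> conj x = x.
Proof.
case: RC x => [|] x //= x0.
by have [y ->] := complex_realP x (ger0_real x0); rewrite conjc_real.
Qed.

Lemma nonneg_sqrt (x : K) : 0 <= x -> exists2 y, 0 <= y & y * y = x.
Proof.
case: RC x => [|] x x0.
  by exists (Num.sqrt x); rewrite ?sqrtr_ge0 // -expr2 sqr_sqrtr.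
by exists (sqrtC x); rewrite ?sqrtC_ge0 // -expr2 sqrtCK.
Qed.

Definition sqnorm n (v : 'rV[K]_n) : K := (v *m v^H) 0 0.

Lemma sqnorm_ge0 n (v : 'rV[K]_n) : 0 <= sqnorm v.
Proof.
by rewrite /sqnorm mxE sumr_ge0 // => i _; rewrite !mxE (rc_mul_conj_ge0 RC).
Qed.

Lemma sqnorm_eq0 n (v : 'rV[K]_n) : sqnorm v = 0 -> v = 0.
Proof.
move=> v0; apply: (mulmx_ctrmx_eq0 RC).
by rewrite [LHS]mx11_scalar -/(sqnorm v) v0 raddf0.
Qed.

Lemma hermitian_eigenvalue_real n (H : 'M[K]_n) a (v : 'rV_n) :
  H^H = H -> v != 0 -> v *m H = a *: v -> conj a = a.
Proof.
move=> hermH v0 vH; have v2 : v *m v^H != 0.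
  by apply: contraNneq v0 => /(mulmx_ctrmx_eq0 RC)->.
have /eqP : conj a *: (v *m v^H) = a *: (v *m v^H).
  by rewrite [in RHS]scalemxAl -vH -mulmxA -{1}hermH -ctrmxM vH ctrmxZ scalemxAr.
by rewrite -subr_eq0 -scalerBl scaler_eq0 (negbTE v2) orbF subr_eq0 => /eqP.
Qed.

End ConjugateTranspose.

(** * Orthonormal bases and the spectral theorem *)

Section Spectral.
Variables (R : realType) (K : numFieldType) (conj : {rmorphism K -> K}).
Hypothesis RC : real_or_complex R conj.
Local Notation "M ^H" := (ctrmx conj M) (at level 2, format "M ^H").
Local Notation unitary := (Defs.is_unitary conj).

(** A real symmetric matrix gets a complex eigenvalue from algebraic closedness;
    being real, it is a root of the original characteristic polynomial, hence has
    a real eigenvector too. *)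
Lemma hermitian_eigenvector n (H : 'M[K]_n.+1) : H^H = H ->
  exists a, exists2 v : 'rV_n.+1, v != 0 & v *m H = a *: v.
Proof.
have closed_eigenvalue (H' : 'M[R[i]]_n.+1) : exists a, eigenvalue H' a.
  have [|a] := @closed_rootP _ (char_poly H') _; first by rewrite size_char_poly.
  by rewrite -eigenvalue_root_char; exists a.
case: RC H => [|] H hermH; last first.
  by have [a /eigenvalueP[v vH v0]] := closed_eigenvalue H; exists a, v.
pose f := real_complex R; have [a eig_a] := closed_eigenvalue (map_mx f H).
have sym : ctrmx (@conjc R) (map_mx f H) = map_mx f H.
  by rewrite -{2}hermH; apply/matrixP=> i j; rewrite !mxE; apply: conjc_real.
have [b ab] : exists b, a = f b.
  apply/complex_realP/CrealP; have [v vH v0] := eigenvalueP eig_a.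
  exact: (hermitian_eigenvalue_real (ComplexScalars R) sym v0 vH).
have : eigenvalue H b.
  have : root (map_poly f (char_poly H)) (f b).
    by rewrite -ab map_char_poly -eigenvalue_root_char.
  by rewrite fmorph_root -eigenvalue_root_char.
by case/eigenvalueP=> w wH w0; exists b, w.
Qed.

Lemma normalize_row n (v : 'rV[K]_n) :
  v != 0 -> exists c, (c *: v) *m (c *: v)^H = 1%:M.
Proof.
move=> v0; have [y y0 yy] := nonneg_sqrt RC (sqnorm_ge0 RC v).
have y_neq0 : y != 0.
  apply: contraNneq v0 => y00; apply/eqP/(sqnorm_eq0 RC).
  by rewrite -yy y00 mul0r.
exists y^-1; rewrite ctrmxZ -scalemxAl -scalemxAr scalerA [v *m _]mx11_scalar.
rewrite -/(sqnorm conj v) -yy (conj_nonneg RC) ?invr_ge0 // scale_scalar_mx.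
by rewrite -invfM mulVf // mulf_neq0.
Qed.

(** Gram-Schmidt in the form that later completions need: a unit vector u of the
    row space is chosen and the induction continues in the part of the row space
    orthogonal to u, whose dimension drops by at most one. *)
Lemma orthonormal_rows r p n (M : 'M[K]_(p, n)) : (r <= \rank M)%N ->
  exists2 W : 'M[K]_(r, n), (W <= M)%MS & W *m W^H = 1%:M.
Proof.
elim: r p M => [|r IHr] p M rM.
  by exists 0; rewrite ?sub0mx // [LHS]flatmx0 [RHS]flatmx0.
have v0 : nz_row M != 0 by rewrite nz_row_eq0 -mxrank_eq0 -lt0n (leq_trans _ rM).
have [c uu] := normalize_row v0; set u := c *: _ in uu.
have [|W] := IHr _ (M :&: kermx u^H)%MS.
  rewrite -ltnS; apply: leq_trans rM _.
  by rewrite -(mxrank_mul_ker M u^H) -[leqRHS]add1n leq_add2r rank_leq_col.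
rewrite sub_capmx => /andP[WM /sub_kermxP Wu] WW.
suff: exists2 U : 'M_(1 + r, n), (U <= M)%MS & U *m U^H = 1%:M by [].
exists (col_mx u W).
  by rewrite col_mx_sub WM scalemx_sub ?nz_row_sub.
rewrite ctrmx_col_mx mul_col_row uu Wu WW.
have -> : u *m W^H = 0 by rewrite -[LHS](ctrmxK RC) ctrmxM (ctrmxK RC) Wu ctrmx0.
by rewrite -scalar_mx_block.
Qed.

Lemma orthonormal_complement r s (Y : 'M[K]_(r, r + s)) : Y *m Y^H = 1%:M ->
  exists Z : 'M[K]_(s, r + s), unitary (col_mx Y Z).
Proof.
move=> YY; have [|Z] := @orthonormal_rows s _ _ (kermx Y^H).
  rewrite mxrank_ker -[leqLHS](addKn r) leq_sub2l // rank_ctrmx.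
  exact: rank_leq_row.
move=> /sub_kermxP ZY ZZ; exists Z; rewrite /Defs.is_unitary ctrmx_col_mx mul_col_row.
rewrite YY ZY ZZ.
have -> : Y *m Z^H = 0 by rewrite -[LHS](ctrmxK RC) ctrmxM (ctrmxK RC) ZY ctrmx0.
by rewrite -scalar_mx_block.
Qed.

(** Columns and rows are matched by their numerical index because [r <= p] is a
    consequence of orthonormality, so that no embedding of [ 'I_r ] into [ 'I_p ]
    is at hand in the statement. *)
Lemma extend_to_unitary r p (Y : 'M[K]_(r, p)) : Y *m Y^H = 1%:M ->
  exists2 U : 'M[K]_p, unitary U &
    forall (i : 'I_r) (j : 'I_p), i = j :> nat -> row j U = row i Y.
Proof.
move=> YY; have rp : (r <= p)%N.
  have <- : \rank Y = r; last exact: rank_leq_col.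
  apply/eqP; rewrite eqn_leq rank_leq_row /= -{1}(mxrank1 K r) -YY.
  exact: mxrankM_maxl.
have [s ps] : exists s, p = (r + s)%N by exists (p - r)%N; rewrite subnKC.
subst p; have [Z UU] := orthonormal_complement YY.
exists (col_mx Y Z) => // i j ij.
have -> : j = lshift s i by apply: val_inj.
by rewrite rowKu.
Qed.

Lemma unitary_ctrmx n (U : 'M[K]_n) : unitary U -> unitary U^H.
Proof. by rewrite /Defs.is_unitary (ctrmxK RC) => /mulmx1C. Qed.

(** As P is a projector commuting with H, an eigenvector v of H yields a joint one
    at once: v P if it is nonzero, and v itself otherwise. *)
Lemma joint_eigenvector n (H P : 'M[K]_n.+1) :
    H^H = H -> P *m P = P -> H *m P = P *m H ->
  exists a, exists2 v : 'rV_n.+1, v *m v^H = 1%:M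
    & v *m H = a *: v /\ (v *m P = v \/ v *m P = 0).
Proof.
move=> hermH PP HP; have [a [v v0 vH]] := hermitian_eigenvector hermH.
have [w w0 [wH wP]] : exists2 w : 'rV_n.+1, w != 0
    & w *m H = a *: w /\ (w *m P = w \/ w *m P = 0).
  have [vP|vP] := eqVneq (v *m P) 0; first by exists v => //; split=> //; right.
  exists (v *m P) => //; split; last by left; rewrite -mulmxA PP.
  by rewrite -mulmxA -HP mulmxA vH scalemxAl.
have [c cc] := normalize_row w0; exists a, (c *: w) => //; split.
  by rewrite -scalemxAl wH scalerA mulrC -scalerA.
by case: wP => wP; [left|right]; rewrite -scalemxAl wP ?scaler0.
Qed.

(** Vectors are rows acted on from the right, and the basis is the set of rows of
    W.  A joint unit eigenvector v splits off: H and P preserve its orthogonal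
    complement because they are Hermitian, and the induction hypothesis applies to
    their compressions Z H Z^* and Z P Z^* to an orthonormal basis Z of that
    complement. *)
Lemma joint_diagonalization n (H P : 'M[K]_n) :
    H^H = H -> P^H = P -> P *m P = P -> H *m P = P *m H ->
  exists2 W : 'M[K]_n, unitary W
    & forall i, (exists a, row i W *m H = a *: row i W)
                /\ (row i W *m P = row i W \/ row i W *m P = 0).
Proof.
elim: n H P => [|n IHn] H P hermH hermP PP HP.
  by exists 1%:M => [|[]//]; rewrite /Defs.is_unitary [LHS]flatmx0 [RHS]flatmx0.
have [a [v vv [vH vP]]] := joint_eigenvector hermH PP HP.
have [Z UU] := @orthonormal_complement 1 n _ vv.
have UHU : v^H *m v + Z^H *m Z = 1%:M.
  by rewrite -mul_row_col -ctrmx_col_mx; apply: mulmx1C.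
have [vZ Zv ZZ] : [/\ v *m Z^H = 0, Z *m v^H = 0 & Z *m Z^H = 1%:M].
  move: UU; rewrite /Defs.is_unitary ctrmx_col_mx mul_col_row.
  by rewrite (scalar_mx_block 1 n) => /eq_block_mx[].
have stable (M : 'M[K]_(1 + n)) c :
    M^H = M -> v *m M = c *: v -> Z *m M = Z *m M *m Z^H *m Z.
  move=> hermM vM.
  have MvH : M *m v^H = conj c *: v^H by rewrite -{1}hermM -ctrmxM vM ctrmxZ.
  rewrite -[LHS]mulmx1 -UHU mulmxDr !mulmxA -[Z *m M *m v^H]mulmxA MvH.
  by rewrite -scalemxAr Zv scaler0 mul0mx add0r.
have ZH := stable _ _ hermH vH.
have ZP : Z *m P = Z *m P *m Z^H *m Z.
  by case: vP => vP; [apply: (stable _ 1)|apply: (stable _ 0)];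
    rewrite ?scale1r ?scale0r.
have [||||W WW Wdiag] := IHn (Z *m H *m Z^H) (Z *m P *m Z^H).
- by rewrite !ctrmxM (ctrmxK RC) hermH mulmxA.
- by rewrite !ctrmxM (ctrmxK RC) hermP mulmxA.
- by rewrite !mulmxA -ZP -[Z *m P *m P]mulmxA PP.
- by rewrite !mulmxA -ZP -ZH -[Z *m H *m P]mulmxA HP mulmxA.
pose V : 'M_(1 + n) := col_mx v (W *m Z).
have VV : V *m V^H = 1%:M.
  rewrite /V ctrmx_col_mx mul_col_row vv ctrmxM.
  rewrite mulmxA vZ mul0mx -[W *m Z *m v^H]mulmxA Zv mulmx0.
  by rewrite mulmxA -(mulmxA W) ZZ mulmx1 WW -scalar_mx_block.
suff rowsV i : (exists a, row i V *m H = a *: row i V)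
    /\ (row i V *m P = row i V \/ row i V *m P = 0) by exists V.
rewrite /V; case: (split_ordP i) => j ->.
  by rewrite rowKu (ord1 j) row_id; split; [exists a|].
have rowWZ M : Z *m M = Z *m M *m Z^H *m Z ->
    row j (W *m Z) *m M = row j W *m (Z *m M *m Z^H) *m Z.
  by move=> ZM; rewrite row_mul -mulmxA {1}ZM mulmxA.
rewrite rowKd (rowWZ _ ZH) (rowWZ _ ZP) row_mul.
have [[b ->] WP] := Wdiag j; split; first by exists b; rewrite scalemxAl.
by case: WP => ->; [left | right; rewrite mul0mx].
Qed.

End Spectral.

(** * Singular value decompositions with an adapted right basis *)

(** The order of [K] is partial in the complex case, but the nonnegative elements
    form a chain, which is all that sorting requires. *)
Lemma sort_nonneg (K : numFieldType) n (d : 'I_n -> K) :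
    (forall i, 0 <= d i) ->
  exists s : 'S_n, forall i j : 'I_n, (i <= j)%N -> d (s j) <= d (s i).
Proof.
move=> d0; pose t := [tuple d i | i < n].
have [s ts] : exists s : 'S_n, sort >=%R t = [tuple tnth t (s i) | i < n].
  by apply/tuple_permP; rewrite perm_sort.
exists s => i j ij.
have nth_sort (l : 'I_n) : nth 0 (sort >=%R t) l = d (s l).
  by rewrite ts -(tnth_nth 0 [tuple tnth t (s i0) | i0 < n]) !tnth_mktuple.
have size_t : size (sort >=%R t) = n by rewrite size_sort size_tuple.
rewrite -!nth_sort; apply: (@sorted_leq_nth _ >=%R) => //.
- exact: ge_trans.
- by move=> x /=.
- apply: (@sort_sorted_in _ [pred x : K | 0 <= x]) => [x y x0 y0|] /=.
    exact: (real_leVge (ger0_real y0) (ger0_real x0)).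
  by apply/allP=> _ /mapP[l _ ->]; apply: d0.
- by rewrite inE size_t.
- by rewrite inE size_t.
Qed.

Lemma initial_segment n (p : pred 'I_n) :
    (forall i j : 'I_n, (i <= j)%N -> p j -> p i) ->
  exists2 r, (r <= n)%N & forall i, p i = (i < r)%N.
Proof.
move=> p_closed; exists (find (predC p) (enum 'I_n)) => [|i].
  by rewrite -[leqRHS](size_enum_ord n) find_size.
apply/idP/idP => [pi|/(before_find i)]; last by rewrite nth_ord_enum => /negbFE.
rewrite ltnNge; apply/negP=> ri.
have lt_r : (find (predC p) (enum 'I_n) < n)%N := leq_ltn_trans ri (ltn_ord i).
have /(nth_find i) /negP[] : has (predC p) (enum 'I_n).
  by rewrite has_find size_enum_ord.
by rewrite (nth_ord_enum i (Ordinal lt_r)); apply: p_closed pi.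
Qed.

Section SVD.
Variables (R : realType) (K : numFieldType) (conj : {rmorphism K -> K}).
Hypothesis RC : real_or_complex R conj.
Local Notation "M ^H" := (ctrmx conj M) (at level 2, format "M ^H").
Local Notation unitary := (Defs.is_unitary conj).

Lemma gramE p q n (M : 'M[K]_(p, n)) (N : 'M_(q, n)) i j :
  (M *m N^H) i j = (row i M *m (row j N)^H) 0 0.
Proof. by rewrite !mxE; apply: eq_bigr => l _; rewrite !mxE. Qed.

(** For a unit eigenvector w of A^* A the eigenvalue is the squared norm of
    w A^*, so sorting by these norms puts the singular values in order. *)
Lemma sorted_joint_diagonalization m n (A : 'M[K]_(m, n)) (P : 'M[K]_n) :
    P^H = P -> P *m P = P -> A^H *m A *m P = P *m (A^H *m A) ->
  exists W : 'M[K]_n, [/\ unitary W,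
    forall i, (exists a, row i W *m (A^H *m A) = a *: row i W)
              /\ (row i W *m P = row i W \/ row i W *m P = 0)
    & forall i j : 'I_n, (i <= j)%N ->
        sqnorm conj (row j W *m A^H) <= sqnorm conj (row i W *m A^H)].
Proof.
move=> hermP PP AAP.
have hermAA : (A^H *m A)^H = A^H *m A by rewrite ctrmxM (ctrmxK RC).
have [W WW Wdiag] := joint_diagonalization RC hermAA hermP PP AAP.
have [s s_sorted] := sort_nonneg (fun i => sqnorm_ge0 RC (row i W *m A^H)).
have row_sW i : row i (row_perm s W) = row (s i) W.
  by apply/rowP=> j; rewrite !mxE.
exists (row_perm s W); split=> [|i|i j ij]; last by rewrite !row_sW s_sorted.
  apply/matrixP=> i j; rewrite gramE !row_sW -gramE WW.
  by rewrite !mxE (inj_eq perm_inj).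
by rewrite row_sW.
Qed.

(** The rows of W are an eigenbasis of A^* A adapted to P.  Their images, the rows
    of Y = W A^*, are pairwise orthogonal, their norms are the singular values, and
    the nonzero ones, normalized, are the first left singular vectors; any unitary
    completion U then satisfies Y = S^* U, which is the decomposition sought. *)
Lemma adapted_svd m n (A : 'M[K]_(m, n)) (P : 'M[K]_n) :
    P^H = P -> P *m P = P -> A^H *m A *m P = P *m (A^H *m A) ->
  exists U S V, is_svd conj A U S V /\
    exists I : {set 'I_n}, forall i, P *m col i V = (i \in I)%:R *: col i V.
Proof.
move=> hermP PP AAP.
have [W [WW Wdiag W_sorted]] := sorted_joint_diagonalization hermP PP AAP.
pose Y := W *m A^H.
have [sg sg0 sgY] : exists2 sg : 'I_n -> K,
    forall i, 0 <= sg i & forall i, sg i ^+ 2 = sqnorm conj (row i Y).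
  apply: (@fin_all_exists2 _ (fun=> K) (fun i x => 0 <= x)
            (fun i x => x ^+ 2 = sqnorm conj (row i Y))) => i.
  have [y y0 yy] := nonneg_sqrt RC (sqnorm_ge0 RC (row i Y)).
  by exists y; rewrite // expr2 yy.
have sg_sorted (i j : 'I_n) : (i <= j)%N -> sg j <= sg i.
  by move=> ij; rewrite -ler_sqr ?nnegrE // !sgY /Y !row_mul W_sorted.
have [r rn sg_gt0] : exists2 r, (r <= n)%N & forall i, (0 < sg i) = (i < r)%N.
  by apply: initial_segment => i j /sg_sorted sgij /lt_le_trans; apply.
have Y0 (i : 'I_n) : (r <= i)%N -> row i Y = 0.
  move=> ri; apply: (sqnorm_eq0 RC); rewrite -sgY; apply/eqP.
  by rewrite sqrf_eq0 eq_le sg0 andbT real_leNgt ?ger0_real // sg_gt0 -leqNgt.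
have Yorth i j : i != j -> row i Y *m (row j Y)^H = 0.
  move=> ij; rewrite !row_mul ctrmxM (ctrmxK RC) mulmxA -(mulmxA (row i W)).
  have [[a ->] _] := Wdiag i; rewrite -scalemxAl [_ *m _]mx11_scalar -gramE WW.
  by rewrite mxE (negbTE ij) raddf0 scaler0.
pose w := widen_ord rn.
pose Y1 := \matrix_(i < r) ((sg (w i))^-1 *: row (w i) Y).
have sgw i : 0 < sg (w i) by rewrite sg_gt0; apply: (ltn_ord i).
have Y1_orth : Y1 *m Y1^H = 1%:M.
  apply/matrixP=> i j; rewrite gramE !rowK ctrmxZ -scalemxAl -scalemxAr scalerA.
  rewrite [RHS]mxE; have [->|ij] := eqVneq i j; last first.
    by rewrite Yorth ?scaler0 ?mxE.
  rewrite mxE -/(sqnorm conj _) -sgY (conj_nonneg RC) ?invr_ge0 ?sg0 //.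
  by rewrite -invfM -expr2 mulVf // sqrf_eq0 gt_eqF.
have [U UU UY1] := extend_to_unitary RC Y1_orth.
have rankY1 : \rank Y1 = r.
  apply/eqP; rewrite eqn_leq rank_leq_row /= -{1}(mxrank1 K r) -Y1_orth.
  exact: mxrankM_maxl.
have rm : (r <= m)%N by rewrite -rankY1 rank_leq_col.
have rowY (i : 'I_n) (ir : (i < r)%N) : row i Y = sg i *: row (Ordinal ir) Y1.
  have wi : w (Ordinal ir) = i by apply: val_inj.
  by rewrite rowK wi scalerA mulfV ?scale1r // gt_eqF // -wi.
have rankA : \rank A = r.
  rewrite -rankY1; have uW := (mulmx1_unit WW).1.
  have -> : \rank A = \rank Y.
    by rewrite -(rank_ctrmx conj A) /Y eqmxMfull // row_full_unit.
  apply/eqP; rewrite eqn_leq !mxrankS //; apply/row_subP=> i.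
    by rewrite rowK scalemx_sub ?row_sub.
  have [ri|ir] := leqP r i; first by rewrite Y0 ?sub0mx.
  by rewrite rowY scalemx_sub ?row_sub.
(* The singular values as a function on nat, extended by 0 to i >= n. *)
pose sigma i := oapp sg 0 (insub i : option 'I_n).
have sigmaE (i : 'I_n) : sigma i = sg i by rewrite /sigma valK.
pose S : 'M[K]_(m, n) :=
  \matrix_(i, j) (if (i == j :> nat) && (i < r)%N then sigma i else 0).
have YE : Y = S^H *m U.
  apply/row_matrixP=> i; rewrite row_mul mulmx_sum_row.
  have [ri|ir] := leqP r i.
    rewrite Y0 // big1 // => j _; rewrite !mxE.
    by case: eqP => [->|_]; rewrite ?ltnNge ?ri rmorph0 scale0r.
  have im := leq_trans ir rm; rewrite (bigD1 (Ordinal im)) //= big1 ?addr0.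
    rewrite !mxE eqxx ir sigmaE (conj_nonneg RC) // rowY.
    by rewrite (UY1 (Ordinal ir)).
  move=> j ji; rewrite !mxE; have [eq_ji|_] := eqVneq (j : nat) i.
    by case/eqP: ji; apply: val_inj.
  by rewrite rmorph0 scale0r.
exists U^H, S, W^H; split; last first.
  exists [set i | row i W *m P == row i W] => i; rewrite inE.
  have -> : col i W^H = (row i W)^H by apply/matrixP=> k l; rewrite !mxE.
  rewrite -{1}hermP -ctrmxM; have [->|rowiP] := eqVneq; first by rewrite scale1r.
  have [_ [rowP|->]] := Wdiag i; last by rewrite ctrmx0 scale0r.
  by rewrite rowP eqxx in rowiP.
split; [exact: (unitary_ctrmx RC)|exact: (unitary_ctrmx RC)| |].
  exists sigma; rewrite rankA; split=> // [i ir|i j ij jr].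
    by rewrite (sigmaE (w (Ordinal ir))).
  have ir := leq_ltn_trans ij jr.
  rewrite (sigmaE (w (Ordinal ir))) (sigmaE (w (Ordinal jr))).
  exact: sg_sorted.
have AH : A^H = W^H *m (S^H *m U) by rewrite -YE mulmxA (mulmx1C WW) mul1mx.
by rewrite -[LHS](ctrmxK RC) AH !ctrmxM !(ctrmxK RC).
Qed.

Lemma is_svd_ctrmx m n (A : 'M[K]_(m, n)) U S V :
  is_svd conj A U S V -> is_svd conj A^H V S^H U.
Proof.
case=> UU VV [sigma [sigma_gt0 sigma_sorted ->]] defA; split=> //; last first.
  by rewrite {1}defA !ctrmxM (ctrmxK RC) mulmxA.
exists sigma; rewrite rank_ctrmx; split=> //; apply/matrixP=> i j; rewrite !mxE.
rewrite eq_sym; case: eqP => [->|_]; last by rewrite rmorph0.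
case: ifP => [ir|_]; last by rewrite rmorph0.
by rewrite (conj_nonneg RC) // ltW // sigma_gt0.
Qed.

(** * The reverse order law *)

Lemma penrose_ctrmx m n (A : 'M[K]_(m, n)) A' :
  penrose conj A A' -> penrose conj A^H A'^H.
Proof.
case=> A1 A2 A3 A4; split; rewrite -!ctrmxM ?A3 ?A4 //.
- by rewrite mulmxA A1.
- by rewrite mulmxA A2.
Qed.

Lemma penrose_proj_idem m n (A : 'M[K]_(m, n)) A' :
  penrose conj A A' -> A *m A' *m (A *m A') = A *m A'.
Proof. by case=> A1 _ _ _; rewrite mulmxA A1. Qed.

(** Half of Greville's criterion for the reverse order law.  The first Penrose
    equation gives Q P Q P = Q P, which for orthogonal projectors means that they
    commute; the third says that A P A^+ is Hermitian, and multiplying that by A^*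
    on the left and by A on the right gives A^* A P Q = Q P A^* A, from which Q
    disappears since A Q = A. *)
Lemma reverse_order_commute m n k (A : 'M[K]_(m, n)) (B : 'M[K]_(n, k)) A' B' :
    penrose conj A A' -> penrose conj B B' ->
    penrose conj (A *m B) (B' *m A') ->
  A^H *m A *m (B *m B') = B *m B' *m (A^H *m A).
Proof.
move=> pA pB [AB1 _ AB3 _]; have [A1 A2 _ A4] := pA; have [_ _ B3 _] := pB.
set P := B *m B' in B3 *; pose Q := A' *m A.
have PP : P *m P = P := penrose_proj_idem pB.
have QQ : Q *m Q = Q by rewrite /Q mulmxA A2.
have hermQ : Q^H = Q := A4.
have AB3' : A *m P *m A' = A'^H *m P *m A^H.
  have APA' : A *m P *m A' = A *m B *m (B' *m A') by rewrite /P !mulmxA.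
  by rewrite APA' -AB3 -APA' ctrmxM [(A *m P)^H]ctrmxM B3 mulmxA.
have QPQP : Q *m P *m Q *m P = Q *m P.
  have := congr1 (fun X => A' *m X *m B') AB1.
  by rewrite /Q /P !mulmxA.
have AQ : A *m Q = A by rewrite /Q mulmxA.
have QA : Q *m A^H = A^H by rewrite -hermQ -ctrmxM AQ.
have A'A : A' *m A = Q by [].
clearbody P Q.
have PQPQP : P *m Q *m P *m Q *m P = P *m Q *m P.
  by have := congr1 (mulmx P) QPQP; rewrite !mulmxA.
(* X = P Q - P Q P vanishes because X X^* does. *)
have PQP : P *m Q = P *m Q *m P.
  apply: subr0_eq; apply: (mulmx_ctrmx_eq0 RC).
  rewrite ctrmxB !ctrmxM B3 hermQ mulmxBl !mulmxBr !mulmxA PQPQP.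
  rewrite -[P *m Q *m Q]mulmxA QQ -[P *m Q *m P *m P]mulmxA PP PQPQP.
  by rewrite !subrr.
have PQ : P *m Q = Q *m P.
  by rewrite -[Q *m P](ctrmxK RC) ctrmxM B3 hermQ PQP !ctrmxM B3 hermQ mulmxA.
have AAPQ : A^H *m A *m P *m Q = Q *m P *m (A^H *m A).
  have := congr1 (fun X => A^H *m X *m A) AB3'.
  by rewrite !mulmxA -ctrmxM -[_ *m A' *m A]mulmxA A'A hermQ.
have AAP : A^H *m A *m P = A^H *m A *m P *m Q.
  by rewrite -[RHS]mulmxA PQ -{2}AQ !mulmxA.
by rewrite AAP AAPQ -PQ -mulmxA [Q *m _]mulmxA QA.
Qed.

End SVD.

(** * Column spaces *)

Section ColumnSpaces.
Variable K : fieldType.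

Lemma mulmx_sum_col p q (M : 'M[K]_(p, q)) (x : 'cV_q) :
  M *m x = \sum_i x i 0 *: col i M.
Proof.
apply/colP=> i; rewrite summxE mxE; apply: eq_bigr => j _.
by rewrite !mxE mulrC.
Qed.

Lemma mem_colspace p q (M : 'M[K]_(p, q)) (x : 'cV_q) : M *m x \in colspace M.
Proof.
rewrite mulmx_sum_col memv_suml // => i _; apply/memvZ/memv_span.
by apply: map_f; rewrite mem_enum.
Qed.

Lemma colspace_sub p q s (M : 'M[K]_(p, q)) (N : 'M_(p, s)) X :
  M = N *m X -> (colspace M <= colspace N)%VS.
Proof.
by move=> ->; apply/span_subvP=> _ /mapP[j _ ->]; rewrite colE -mulmxA mem_colspace.
Qed.

(** Expanding M = (M V) V' writes the columns of M as combinations of the columns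
    of V that M fixes; conversely a column fixed by M lies in its column space. *)
Lemma colspace_diagonalized n (M V V' : 'M[K]_n) (p : pred 'I_n) :
    V *m V' = 1%:M -> (forall i, M *m col i V = (p i)%:R *: col i V) ->
  colspace M = colspan V p.
Proof.
move=> VV' MV; apply: subv_anti; apply/andP; split; apply/span_subvP=> v.
  case/mapP=> j _ ->; rewrite colE -[M]mulmx1 -VV' mulmxA -mulmxA mulmx_sum_col.
  rewrite memv_suml // => i _; have -> : col i (M *m V) = (p i)%:R *: col i V.
    by rewrite -MV !colE mulmxA.
  apply/memvZ; case pi: (p i); last by rewrite scale0r mem0v.
  by rewrite scale1r; apply/memv_span/map_f; rewrite mem_filter pi mem_enum.
case/mapP=> i; rewrite mem_filter => /andP[pi _] ->.
by have := mem_colspace M (col i V); rewrite MV pi scale1r.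
Qed.

End ColumnSpaces.

(** * Singular vectors and null spaces *)

Section SingularVectors.
Variables (R : realType) (K : numFieldType) (conj : {rmorphism K -> K}).
Hypothesis RC : real_or_complex R conj.
Local Notation "M ^H" := (ctrmx conj M) (at level 2, format "M ^H").
Local Notation unitary := (Defs.is_unitary conj).

Lemma svd_col0 m n (A : 'M[K]_(m, n)) U S V (i : 'I_n) :
  is_svd conj A U S V -> (\rank A <= i)%N -> A *m col i V = 0.
Proof.
case=> _ VV [sigma [_ _ defS]] defA ri.
rewrite colE {1}defA -mulmxA (mulmxA V^H) (mulmx1C VV) mul1mx -mulmxA -colE.
have -> : col i S = 0; last by rewrite mulmx0.
apply/colP=> j; rewrite defS !mxE.
by case: eqP => [->|//]; rewrite ltnNge ri.
Qed.

Lemma svd_col m n (A : 'M[K]_(m, n)) U S V (i : 'I_n) (j : 'I_m) :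
    is_svd conj A U S V -> (i < \rank A)%N -> i = j :> nat ->
  exists2 s, s != 0 & A *m col i V = s *: col j U.
Proof.
case=> _ VV [sigma [sigma_gt0 _ defS]] defA ir ij.
exists (sigma i); first by rewrite gt_eqF ?sigma_gt0.
rewrite [in LHS]colE {1}defA -mulmxA (mulmxA V^H) (mulmx1C VV) mul1mx -mulmxA.
rewrite -colE [col j U]colE scalemxAr; congr (_ *m _).
apply/colP=> l; rewrite defS !mxE eqxx andbT.
have [->|lj] := eqVneq l j; first by rewrite -ij eqxx ir mulr1.
by rewrite ij (inj_eq val_inj) (negbTE lj) mulr0.
Qed.

(** A^+ A is the orthogonal projector onto C(A^* ), and the leading right singular
    vectors lie there, being multiples of A^* u for left singular vectors u, while
    the others are killed by A. *)
Lemma penrose_svd m n (A : 'M[K]_(m, n)) A' U S V i :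
    penrose conj A A' -> is_svd conj A U S V ->
  A' *m A *m col i V = (i < \rank A)%N%:R *: col i V.
Proof.
move=> [A1 _ _ A4] svdA; have [ri|ir] := leqP (\rank A) i.
  by rewrite -mulmxA (svd_col0 svdA) // mulmx0 scale0r.
pose j := Ordinal (leq_trans ir (rank_leq_row A)).
have rH : (j < \rank A^H)%N by rewrite rank_ctrmx.
have [s s0 Au] := svd_col (i := j) (j := i) (is_svd_ctrmx RC svdA) rH erefl.
have -> : col i V = s^-1 *: (A^H *m col j U) by rewrite Au scalerA mulVf ?scale1r.
by rewrite scale1r -scalemxAr mulmxA -{1}A4 -ctrmxM mulmxA A1.
Qed.

Lemma notin_nullspace m n (A : 'M[K]_(m, n)) A' (u : 'cV_n) (b : bool) :
    penrose conj A A' -> u != 0 -> A' *m A *m u = b%:R *: u ->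
  (u \notin nullspace A) = b.
Proof.
move=> [A1 _ _ _] u0 Qu; rewrite mem_nullspace; case: b Qu => Qu.
  apply: contra_neqN u0 => /eqP Au.
  by rewrite -[u]scale1r -Qu -mulmxA Au mulmx0.
by rewrite -A1 -!mulmxA (mulmxA A') Qu scale0r mulmx0 eqxx.
Qed.

Lemma unitary_col_neq0 n (V : 'M[K]_n) i : unitary V -> col i V != 0.
Proof.
move=> VV; apply/eqP=> V0; have /eqP := congr1 (mulmx V^H) V0.
rewrite colE mulmxA (mulmx1C VV) mul1mx mulmx0 => /eqP /colP/(_ i)/eqP.
by rewrite !mxE !eqxx oner_eq0.
Qed.

End SingularVectors.

(** * Adapted decompositions of a pair satisfying the reverse order law *)

Theorem theorem5p2
    (R : realType) (K : numFieldType) (conj : {rmorphism K -> K})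
    (hK : real_or_complex R conj)
    (m n k : nat) (A : 'M[K]_(m, n)) (B : 'M[K]_(n, k))
    (hA : A <> 0) (hB : B <> 0)
    (hAB : mp_pinv conj (A *m B) = mp_pinv conj B *m mp_pinv conj A) :
  exists (UA : 'M[K]_m) (SA : 'M[K]_(m, n)) (VA : 'M[K]_n)
         (UB : 'M[K]_n) (SB : 'M[K]_(n, k)) (VB : 'M[K]_k),
    [/\ is_svd conj A UA SA VA,
        is_svd conj B UB SB VB,
        exists I : {set 'I_n},
          colspace B = colspan VA (fun i => i \in I),
        exists J : {set 'I_n},
          colspace (ctrmx conj A) = colspan UB (fun j => j \in J)
      & colspan UB (fun i => (i < \rank B)%N
                             && (col i UB \notin nullspace A))
        = colspan VA (fun i => (i < \rank A)%N
                               && (col i VA \notin nullspace (ctrmx conj B)))].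
Proof.
set A' := mp_pinv conj A in hAB; set B' := mp_pinv conj B in hAB.
have pA : penrose conj A A' := mp_pinvP hK A.
have pB : penrose conj B B' := mp_pinvP hK B.
have pAB : penrose conj (A *m B) (B' *m A').
  by rewrite -hAB; apply: (mp_pinvP hK).
have pAH := penrose_ctrmx pA; have pBH := penrose_ctrmx pB.
have pABH := penrose_ctrmx pAB; rewrite !ctrmxM in pABH.
clearbody A' B'.
have [A1 _ _ A4] := pA; have [B1 _ B3 _] := pB.
pose P := B *m B'; pose Q := A' *m A.
have defQ : ctrmx conj A *m ctrmx conj A' = Q by rewrite -ctrmxM A4.
have defP : ctrmx conj B' *m ctrmx conj B = P by rewrite -ctrmxM B3.
have QQ : Q *m Q = Q by rewrite -defQ (penrose_proj_idem pAH).
have AAP := reverse_order_commute hK pA pB pAB.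
have := reverse_order_commute hK pBH pAH pABH; rewrite defQ => BBQ.
have [UA [SA [VA [svdA [I PV]]]]] := adapted_svd hK B3 (penrose_proj_idem pB) AAP.
have [VB [SB [UB [svdBH [J QU]]]]] := adapted_svd hK A4 QQ BBQ.
have VAu : Defs.is_unitary conj VA by case: svdA.
have UBu : Defs.is_unitary conj UB by case: svdBH.
have svdB := is_svd_ctrmx hK svdBH; rewrite (ctrmxK hK) in svdB.
exists UA, SA, VA, UB, (ctrmx conj SB), VB; split=> //.
- exists I; rewrite -(colspace_diagonalized VAu PV); apply: subv_anti.
  by rewrite (colspace_sub (esym B1)) (colspace_sub (erefl P)).
- exists J; rewrite -(colspace_diagonalized UBu QU); apply: subv_anti.
  have [AH1 _ _ _] := pAH; rewrite defQ in AH1.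
  by rewrite (colspace_sub (esym AH1)) (colspace_sub (esym defQ)).
transitivity (colspace (P *m Q)).
  apply/esym/(colspace_diagonalized UBu) => i.
  rewrite (notin_nullspace pA (unitary_col_neq0 i UBu) (QU i)).
  rewrite -mulmxA QU -scalemxAr -defP (penrose_svd hK _ pBH svdBH) rank_ctrmx.
  by rewrite scalerA andbC -mulnb natrM.
apply/(colspace_diagonalized VAu) => i.
rewrite (notin_nullspace pBH (unitary_col_neq0 i VAu) (b := i \in I)) ?defP //.
rewrite -mulmxA (penrose_svd hK _ pA svdA) -scalemxAr PV.
by rewrite scalerA -mulnb natrM.
Qed.
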